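(* For integers $n\ge 1$ put $\varepsilon_n=\frac{1+(-1)^n}{2}$, so that $1-\varepsilon_n=\frac{1-(-1)^n}{2}$. For integers $p>q\ge0$ let $$a_{p,q}=(-1)^{\frac12[q-\varepsilon_p]}\bigl[1-(-1)^{p-q}\bigr]\sum_{\ell=0}^{\frac{p-q-1}2}(-1)^{\ell}\binom{p+1}{\ell}\Bigl(\frac{p-q-1}2-\ell+1\Bigr)^p .$$ Then for every $n\in\mathbb{N}=\{1,2,3,\dots\}$ the following two formulas hold. For every real $x$ with $\cos x\neq0$, $$\tan^{(n)}x=\frac1{\cos^{n+1}x}\Biggl\{\frac12(1+\varepsilon_n)\,a_{n,\varepsilon_n}\sin\Bigl[\varepsilon_n x+(1-\varepsilon_n)\frac\pi2\Bigr]+\sum_{k=1}^{\frac12[n-1-\varepsilon_n]}a_{n,2k+\varepsilon_n}\sin\Bigl[(2k+\varepsilon_n)x+(1-\varepsilon_n)\frac\pi2\Bigr]\Biggr\}.$$ For every real $x$ with $\sin x\neq0$, $$\cot^{(n)}x=\frac{(-1)^n}{\sin^{n+1}x}\Biggl\{\frac12(1+\varepsilon_n)\,a_{n,\varepsilon_n}\cos[\varepsilon_n x]+\sum_{k=1}^{\frac12[n-1-\varepsilon_n]}(-1)^k a_{n,2k+\varepsilon_n}\cos\bigl[(2k+\varepsilon_n)x\bigr]\Biggr\}.$$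
   Context: $f^{(n)}x$ denotes the $n$-th derivative of the function $f$ at $x$. Empty sums are $0$. Because of the factor $1-(-1)^{p-q}$, $a_{p,q}$ is understood to be $0$ when $p-q$ is even; in the formulas for the derivatives only pairs with $p-q$ odd occur, and then $\frac12[q-\varepsilon_p]$ and $\frac{p-q-1}{2}$ are integers. Likewise $\frac12[n-1-\varepsilon_n]$ is always a nonnegative integer. *)

(* Defs.v *)
From Stdlib Require Import Reals Lra Arith.
From Coquelicot Require Import Coquelicot.
Open Scope R_scope.

(** [eps n] is (1 + (-1)^n) / 2, kept in [nat] because it is used inside
    indices; see [eps_spec]. *)
Definition eps (n : nat) : nat := if Nat.even n then 1%nat else 0%nat.

Lemma eps_spec (n : nat) : INR (eps n) = (1 + (-1) ^ n) / 2.
Proof.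
unfold eps; destruct (Nat.even n) eqn:E.
- apply Nat.even_spec in E; destruct E as [m ->].
  rewrite pow_1_even; simpl; lra.
- assert (O : Nat.odd n = true) by (unfold Nat.odd; rewrite E; reflexivity).
  apply Nat.odd_spec in O; destruct O as [m ->].
  replace (2 * m + 1)%nat with (S (2 * m)) by (rewrite Nat.add_1_r; reflexivity).
  rewrite pow_1_odd; simpl; lra.
Qed.

(** For [p > q] with [p - q] odd, the subtractions in [nat] below do not
    truncate and both halvings are exact: [q] and [eps p] have the same parity
    and [eps p <= q].  When [p - q] is even the factor [1 - (-1) ^ (p - q)]
    vanishes, so [a p q] is 0 as intended whatever the other factors are; see
    [a_even].  [Binomial.C] is the binomial coefficient as a real. *)
Definition a (p q : nat) : R :=
  (-1) ^ ((q - eps p) / 2) * (1 - (-1) ^ (p - q)) *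
  sum_n (fun l : nat =>
           (-1) ^ l * Binomial.C (p + 1) l *
           (INR ((p - q - 1) / 2) - INR l + 1) ^ p)
        ((p - q - 1) / 2).

Lemma a_even (p q : nat) : Nat.Even (p - q) -> a p q = 0.
Proof.
intros [m E]; unfold a; rewrite E, pow_1_even; ring.
Qed.

Definition cot (x : R) : R := cos x / sin x.

(* Main.v *)
(** Write [cot_num n x] for the sum over [m] of [A(n,m) cos ((n - 1 - 2m) x)], where
    [A(n,m)] are the Eulerian numbers.  The [n]-th derivative of [cot] is
    [(-1)^n cot_num n / sin^(n+1)]: differentiating once more and linearizing the
    products [cos * cos] and [sin * sin] reproduces exactly the recursion
    [A(n+1,m) = (m+1) A(n,m) + (n+1-m) A(n,m-1)].  This recursion is also
    satisfied by the alternating binomial sum in [a p q], so that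
    [a n q] is [2 A(n, (n-1-q)/2)] up to sign, and the symmetry
    [A(n,m) = A(n,n-1-m)] folds [cot_num n] into the stated half sum.  The formula
    for [tan] follows from [tan x = - cot (x + PI/2)]. *)
Require Import Defs.
From Stdlib Require Import Reals Lra Lia.
From Coquelicot Require Import Coquelicot.
Open Scope R_scope.

(** * Folding finite sums about their centre *)

Lemma sum_f_R0_S_shift (f : nat -> R) (n : nat) :
  sum_f_R0 f (S n) = f 0%nat + sum_f_R0 (fun k => f (S k)) n.
Proof. now rewrite decomp_sum by lia. Qed.

Lemma sum_n_m_S_R (f : nat -> R) (n : nat) :
  sum_n_m f 1 (S n) = sum_n_m f 1 n + f (S n).
Proof. now rewrite sum_n_Sm by lia. Qed.

Lemma sum_n_m_ext_R (f g : nat -> R) (m n : nat) :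
  (forall k, (m <= k <= n)%nat -> f k = g k) -> sum_n_m f m n = sum_n_m g m n.
Proof. exact (sum_n_m_ext_loc f g m n). Qed.

(** Each induction step strips the first and last terms; [f] stays general because the hypothesis is
    applied to its shift. *)
Lemma sum_f_R0_fold_odd_size (j : nat) (f : nat -> R) :
  sum_f_R0 f (2 * j) =
  f j + sum_n_m (fun k => f (j - k)%nat + f (j + k)%nat) 1 j.
Proof.
revert f; induction j as [|j IH]; intros f.
- rewrite sum_n_m_zero by lia; unfold zero; simpl; ring.
- replace (2 * S j)%nat with (S (S (2 * j))) by lia.
  rewrite tech5, sum_f_R0_S_shift, (IH (fun k => f (S k))), sum_n_m_S_R.
  rewrite (sum_n_m_ext_R (fun k => f (S (j - k)) + f (S (j + k)))
             (fun k => f (S j - k)%nat + f (S j + k)%nat)).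
  + replace (S j - S j)%nat with 0%nat by lia.
    replace (S j + S j)%nat with (S (S (2 * j))) by lia.
    ring.
  + intros k Hk; f_equal; f_equal; lia.
Qed.

Lemma sum_f_R0_fold_even_size (j : nat) (f : nat -> R) :
  sum_f_R0 f (2 * j + 1) =
  f j + f (j + 1)%nat +
  sum_n_m (fun k => f (j - k)%nat + f (j + 1 + k)%nat) 1 j.
Proof.
revert f; induction j as [|j IH]; intros f.
- rewrite sum_n_m_zero by lia; unfold zero; simpl; ring.
- replace (2 * S j + 1)%nat with (S (S (2 * j + 1))) by lia.
  rewrite tech5, sum_f_R0_S_shift, (IH (fun k => f (S k))), sum_n_m_S_R.
  rewrite (sum_n_m_ext_R (fun k => f (S (j - k)) + f (S (j + 1 + k)))
             (fun k => f (S j - k)%nat + f (S j + 1 + k)%nat)).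
  + replace (S j - S j)%nat with 0%nat by lia.
    replace (S j + 1 + S j)%nat with (S (S (2 * j + 1))) by lia.
    replace (S j + 1)%nat with (S (j + 1)) by lia.
    ring.
  + intros k Hk; f_equal; f_equal; lia.
Qed.

(** * Binomial coefficients *)

(** Unlike [Binomial.C], [binom n k] vanishes for [k > n]; this makes the
    Eulerian recursion hold without range conditions. *)
Fixpoint binom (n k : nat) : R :=
  match n, k with
  | _, O => 1
  | O, S _ => 0
  | S n', S k' => binom n' k' + binom n' (S k')
  end.

Lemma binom_0_r (n : nat) : binom n 0 = 1.
Proof. now destruct n. Qed.

Lemma binom_gt (n k : nat) : (n < k)%nat -> binom n k = 0.
Proof.
revert k; induction n as [|n IH]; intros [|k] H; try lia; simpl; trivial.
rewrite !IH by lia; ring.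
Qed.

Lemma binom_C (n k : nat) : (k <= n)%nat -> binom n k = Binomial.C n k.
Proof.
revert k; induction n as [|n IH]; intros [|k] H; try lia.
- now rewrite C_n_0.
- now rewrite C_n_0.
- simpl; destruct (Nat.eq_dec k n) as [->|Hk].
  + rewrite IH, (binom_gt n (S n)), !C_n_n by lia; ring.
  + rewrite !IH, pascal by lia; reflexivity.
Qed.

Lemma binom_absorb (n k : nat) :
  (INR k + 1) * binom n (S k) = (INR n - INR k) * binom n k.
Proof.
revert k; induction n as [|n IH]; intros k.
- destruct k; simpl; ring.
- destruct k as [|k].
  + generalize (IH 0%nat); rewrite S_INR; simpl; rewrite binom_0_r; lra.
  + generalize (IH k) (IH (S k)); rewrite !S_INR; simpl binom; lra.
Qed.

(** * Eulerian numbers: recursion, vanishing and symmetry *)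

Definition eulerian (n m : nat) : R :=
  sum_f_R0 (fun l => (-1) ^ l * binom (S n) l * (INR m - INR l + 1) ^ n) m.

Lemma eulerian_0_r (n : nat) : eulerian n 0 = 1.
Proof.
unfold eulerian; cbn [sum_f_R0 binom pow INR].
replace (0 - 0 + 1) with 1 by ring; rewrite pow1; ring.
Qed.

(** Pair term [l + 1] of [eulerian (S n) (S m)] and of [eulerian n (S m)] with term [l] of
    [eulerian n m]: after Pascal's rule their discrepancy is a multiple of [binom_absorb (S n) l].
    The unpaired terms at 0 agree directly. *)
Lemma eulerian_rec (n m : nat) :
  eulerian (S n) (S m) =
  (INR m + 2) * eulerian n (S m) + (INR n - INR m) * eulerian n m.
Proof.
unfold eulerian; rewrite !sum_f_R0_S_shift, Rmult_plus_distr_l, !scal_sum.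
rewrite Rplus_assoc, <- plus_sum; f_equal.
- rewrite !binom_0_r, S_INR; simpl; ring.
- apply sum_eq; intros l _.
  generalize (binom_absorb (S n) l).
  change (binom (S (S n)) (S l)) with (binom (S n) l + binom (S n) (S l)).
  generalize (binom (S n) l) (binom (S n) (S l)); intros b c.
  rewrite !S_INR; cbn [pow].
  replace (INR m + 1 - (INR l + 1) + 1) with (INR m - INR l + 1) by ring.
  generalize ((INR m - INR l + 1) ^ n) ((-1) ^ l); intros u s H.
  apply Rminus_diag_uniq.
  transitivity (s * u * ((INR l + 1) * c - (INR n + 1 - INR l) * b)); [ring|].
  rewrite H; ring.
Qed.

Lemma eulerian_gt (n m : nat) : (n < m)%nat -> eulerian n m = 0.
Proof.
revert m; induction n as [|n IH]; intros [|m] H; try lia.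
- clear H; unfold eulerian; cbn [pow]; induction m as [|m IH].
  + simpl; ring.
  + rewrite tech5, IH, binom_gt by lia; ring.
- rewrite eulerian_rec, !IH by lia; ring.
Qed.

(** Just inside the range left open by [eulerian_gt]: the other term of the recursion dies because
    its factor is [INR n - INR n]. *)
Lemma eulerian_diag (n : nat) : eulerian (S n) (S n) = 0.
Proof. rewrite eulerian_rec, eulerian_gt by lia; ring. Qed.

(** Exchanging [m] and [k] exchanges the two terms of the recursion. When one index is 0 the
    recursion applies to the other side only, and [eulerian_diag] removes one of its terms. *)
Lemma eulerian_sym (m k : nat) :
  eulerian (S (m + k)) m = eulerian (S (m + k)) k.
Proof.
remember (m + k)%nat as n eqn:E; revert m k E.
induction n as [|n IH]; intros m k E.
- now replace m with k by lia.
- destruct m as [|m], k as [|k]; try lia.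
  + simpl in E; injection E as <-.
    rewrite eulerian_rec, eulerian_diag, <- (IH 0%nat n), !eulerian_0_r, S_INR by lia.
    ring.
  + replace m with n by lia.
    rewrite eulerian_rec, eulerian_diag, (IH n 0%nat), !eulerian_0_r, S_INR by lia.
    ring.
  + rewrite (eulerian_rec (S n) m), (eulerian_rec (S n) k), (IH m (S k)), (IH (S m) k) by lia.
    replace n with (m + S k)%nat by lia.
    rewrite !S_INR, !plus_INR, !S_INR; ring.
Qed.

(** * The coefficients [a] and the folded numerator *)

Lemma eps_cases (n : nat) : (1 <= n)%nat ->
  exists j, (n = 2 * j + 1 /\ eps n = 0)%nat \/ (n = 2 * j + 2 /\ eps n = 1)%nat.
Proof.
intros Hn; unfold eps; destruct (Nat.even n) eqn:E.
- apply Nat.even_spec in E; destruct E as [[|i] ->]; [lia|].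
  exists i; right; split; lia.
- assert (O : Nat.odd n = true) by (unfold Nat.odd; now rewrite E).
  apply Nat.odd_spec in O; destruct O as [i ->].
  exists i; left; split; lia.
Qed.

Lemma a_eulerian (n j k : nat) : (n = 2 * j + 1 + eps n)%nat -> (k <= j)%nat ->
  a n (2 * k + eps n) = (-1) ^ k * 2 * eulerian n (j - k).
Proof.
intros Hn Hk; unfold a, eulerian.
replace (2 * k + eps n - eps n)%nat with (k * 2)%nat by lia.
replace (n - (2 * k + eps n))%nat with (S (2 * (j - k))) by lia.
replace (S (2 * (j - k)) - 1)%nat with ((j - k) * 2)%nat by lia.
rewrite !Nat.div_mul, pow_1_odd, sum_n_Reals by lia.
f_equal; [ring|].
apply sum_eq; intros l Hl.
rewrite binom_C, Nat.add_1_r by lia; reflexivity.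
Qed.

(** The range includes [m = n], where [eulerian n m] vanishes unless [n = 0]:
    with it [cot_num 0 x = cos (- x)], so that inductions can start at [0]. *)
Definition cot_num (n : nat) (x : R) : R :=
  sum_f_R0 (fun m => eulerian n m * cos ((INR n - 1 - 2 * INR m) * x)) n.

(** Reflecting [m] to [n - 1 - m] keeps the Eulerian coefficient and negates the frequency, so
    paired cosines coincide. *)
Lemma cot_num_fold (n : nat) (x : R) : (1 <= n)%nat ->
  cot_num n x =
  1 / 2 * (1 + INR (eps n)) * a n (eps n) * cos (INR (eps n) * x) +
  sum_n_m (fun k : nat =>
      (-1) ^ k * a n (2 * k + eps n) * cos (INR (2 * k + eps n) * x))
    1 ((n - 1 - eps n) / 2).
Proof.
intros Hn; destruct (eps_cases n Hn) as [j Hj].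
assert (Hnj : (n = 2 * j + 1 + eps n)%nat) by lia.
replace ((n - 1 - eps n) / 2)%nat with j
  by (replace (n - 1 - eps n)%nat with (j * 2)%nat by lia;
      now rewrite Nat.div_mul by lia).
replace (a n (eps n)) with (2 * eulerian n j)
  by (generalize (a_eulerian n j 0 Hnj (Nat.le_0_l j)); simpl;
      rewrite Nat.sub_0_r; intros ->; ring).
rewrite (sum_n_m_ext_R _
  (fun k => 2 * eulerian n (j - k) * cos (INR (2 * k + eps n) * x))).
(* The explicit sign [(-1) ^ k] cancels the one contained in [a]. *)
2: { intros k Hk; rewrite (a_eulerian n j k Hnj) by lia.
     replace ((-1) ^ k * ((-1) ^ k * 2 * eulerian n (j - k)))
       with (((-1) * (-1)) ^ k * 2 * eulerian n (j - k))
       by (rewrite Rpow_mult_distr; ring).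
     replace ((-1) * (-1)) with 1 by ring; rewrite pow1; ring. }
assert (Esym : forall k, (k <= j)%nat ->
  eulerian n (j + eps n + k) = eulerian n (j - k)).
{ intros k Hk.
  generalize (eulerian_sym (j + eps n + k) (j - k)).
  now replace (S (j + eps n + k + (j - k))) with n by lia. }
assert (E : cot_num n x = sum_f_R0
  (fun m => eulerian n m * cos ((INR n - 1 - 2 * INR m) * x)) (n - 1)).
{ unfold cot_num; destruct n as [|i]; [lia|].
  rewrite tech5, eulerian_diag, Nat.sub_1_r; simpl pred; ring. }
rewrite E; clear E.
assert (EI : INR n = 2 * INR j + 1 + INR (eps n))
  by (rewrite Hnj at 1; rewrite !plus_INR, mult_INR; simpl; ring).
rewrite EI; clear EI.
(* Odd [n] has a single central term, of frequency 0; even [n] has two equal ones, of frequencies 1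
   and -1. This is the origin of the factor [1 + INR (eps n)]. *)
destruct Hj as [[Hj He]|[Hj He]].
- replace (n - 1)%nat with (2 * j)%nat by lia.
  rewrite sum_f_R0_fold_odd_size, He; f_equal.
  + simpl INR; f_equal; [field|f_equal; ring].
  + apply sum_n_m_ext_R; intros k Hk.
    generalize (Esym k (proj2 Hk)); rewrite He, Nat.add_0_r; intros ->.
    rewrite minus_INR, !plus_INR, mult_INR by lia; simpl INR.
    replace ((2 * INR j + 1 + 0 - 1 - 2 * (INR j + INR k)) * x)
      with (- (((1 + 1) * INR k + 0) * x)) by ring.
    rewrite cos_neg.
    replace ((2 * INR j + 1 + 0 - 1 - 2 * (INR j - INR k)) * x)
      with (((1 + 1) * INR k + 0) * x) by ring.
    ring.
- replace (n - 1)%nat with (2 * j + 1)%nat by lia.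
  rewrite sum_f_R0_fold_even_size, He; f_equal.
  + generalize (Esym 0%nat (Nat.le_0_l j)).
    rewrite He, Nat.add_0_r, Nat.sub_0_r; intros ->.
    rewrite plus_INR; simpl INR.
    replace ((2 * INR j + 1 + 1 - 1 - 2 * (INR j + 1)) * x) with (- (1 * x)) by ring.
    rewrite cos_neg.
    replace ((2 * INR j + 1 + 1 - 1 - 2 * INR j) * x) with (1 * x) by ring.
    field.
  + apply sum_n_m_ext_R; intros k Hk.
    generalize (Esym k (proj2 Hk)); rewrite He; intros ->.
    rewrite minus_INR, !plus_INR, mult_INR by lia; simpl INR.
    replace ((2 * INR j + 1 + 1 - 1 - 2 * (INR j + 1 + INR k)) * x)
      with (- (((1 + 1) * INR k + 1) * x)) by ring.
    rewrite cos_neg.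
    replace ((2 * INR j + 1 + 1 - 1 - 2 * (INR j - INR k)) * x)
      with (((1 + 1) * INR k + 1) * x) by ring.
    ring.
Qed.

(** * Derivatives of the cotangent *)

Definition cot_num' (n : nat) (x : R) : R :=
  sum_f_R0 (fun m => eulerian n m *
    (- (INR n - 1 - 2 * INR m) * sin ((INR n - 1 - 2 * INR m) * x))) n.

Lemma is_derive_cot_num (n : nat) (x : R) :
  is_derive (cot_num n) x (cot_num' n x).
Proof.
apply is_derive_ext with (fun y => sum_n (fun m =>
  eulerian n m * cos ((INR n - 1 - 2 * INR m) * y)) n).
- intros y; apply sum_n_Reals.
- unfold cot_num'; rewrite <- sum_n_Reals.
  apply (is_derive_sum_n
    (fun m y => eulerian n m * cos ((INR n - 1 - 2 * INR m) * y))).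
  intros m _; auto_derive; [trivial|ring].
Qed.

(** The right side is the numerator, up to sign, of the derivative of [cot_num n / sin ^ (n + 1)].
    With w = n - 1 - 2m, the product formulas turn (n+1) cos x cos(wx) + w sin x sin(wx) into (m+1)
    cos((w+1)x) + (n-m) cos((w-1)x). *)
Lemma cot_num_S (n : nat) (x : R) :
  cot_num (S n) x = (INR n + 1) * cos x * cot_num n x - sin x * cot_num' n x.
Proof.
set (c := fun i : nat => cos ((INR n - 2 * INR i) * x)).
assert (H : (INR n + 1) * cos x * cot_num n x - sin x * cot_num' n x =
  sum_f_R0 (fun m => (INR m + 1) * eulerian n m * c m) n +
  sum_f_R0 (fun m => (INR n - INR m) * eulerian n m * c (S m)) n).
{ unfold cot_num, cot_num', Rminus.
  rewrite Ropp_mult_distr_l, !scal_sum, <- !plus_sum.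
  apply sum_eq; intros m _; unfold c; rewrite S_INR.
  replace ((INR n - 2 * INR m) * x)
    with ((INR n + - (1) + - (2 * INR m)) * x + x) by ring.
  replace ((INR n - 2 * (INR m + 1)) * x)
    with ((INR n + - (1) + - (2 * INR m)) * x - x) by ring.
  rewrite cos_plus, cos_minus; ring. }
assert (Hlast : sum_f_R0 (fun m => (INR m + 1) * eulerian n m * c m) n =
  eulerian n 0 * c 0%nat +
  sum_f_R0 (fun m => (INR m + 2) * eulerian n (S m) * c (S m)) n).
(* A vanishing term at [S n] is appended, so that splitting off the term at 0 leaves a sum as long
   as the other one. *)
{ rewrite <- (Rplus_0_r (sum_f_R0 _ n)).
  replace 0 with ((INR (S n) + 1) * eulerian n (S n) * c (S n)) at 1
    by (rewrite eulerian_gt by lia; ring).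
  rewrite <- (tech5 (fun m => (INR m + 1) * eulerian n m * c m)), sum_f_R0_S_shift.
  f_equal; [simpl; ring|].
  apply sum_eq; intros m _; rewrite S_INR; ring. }
rewrite H, Hlast, Rplus_assoc, <- plus_sum.
unfold cot_num; rewrite sum_f_R0_S_shift; f_equal.
- rewrite !eulerian_0_r; unfold c; rewrite S_INR; do 2 f_equal; ring.
- apply sum_eq; intros m _; rewrite eulerian_rec; unfold c.
  rewrite (S_INR n).
  replace ((INR n + 1 - 1 - 2 * INR (S m)) * x)
    with ((INR n - 2 * INR (S m)) * x) by ring.
  ring.
Qed.

Lemma is_derive_n_cot (n : nat) (x : R) : sin x <> 0 ->
  is_derive_n cot n x ((-1) ^ n / sin x ^ (n + 1) * cot_num n x).
Proof.
revert x; induction n as [|n IH]; intros x Hx.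
- unfold cot_num, cot, eulerian; simpl.
  replace ((0 - 1 - 2 * 0) * x) with (- x) by ring.
  rewrite cos_neg; now field.
- change (is_derive (Derive_n cot n) x
    ((-1) ^ S n / sin x ^ (S n + 1) * cot_num (S n) x)).
  (* The induction hypothesis may be differentiated because [sin] is nonzero on a whole
     neighbourhood of [x]. *)
  apply is_derive_ext_loc with
    (fun y => (-1) ^ n / sin y ^ (n + 1) * cot_num n y).
  + assert (L : locally x (fun y => sin y <> 0))
      by exact (continuous_sin x _ (open_neq 0 _ Hx)).
    revert L; apply filter_imp; intros y Hy.
    symmetry; apply is_derive_n_unique, IH, Hy.
  + assert (D : is_derive (fun y => (-1) ^ n / sin y ^ (n + 1)) x
      ((-1) ^ S n * (INR n + 1) * cos x / sin x ^ (n + 2))).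
    { auto_derive; [now apply pow_nonzero|].
      rewrite plus_INR, !pow_add; simpl; rewrite Nat.add_1_r; simpl; field.
      split; [exact Hx|now apply pow_nonzero]. }
    replace ((-1) ^ S n / sin x ^ (S n + 1) * cot_num (S n) x) with
      ((-1) ^ S n * (INR n + 1) * cos x / sin x ^ (n + 2) * cot_num n x +
       (-1) ^ n / sin x ^ (n + 1) * cot_num' n x).
    * exact (is_derive_mult _ _ x _ _ D (is_derive_cot_num n x) Rmult_comm).
    * rewrite cot_num_S, !pow_add; simpl; field.
      split; [exact Hx|now apply pow_nonzero].
Qed.

(** * From cotangent to tangent *)

Lemma sin_add_nat_PI (y : R) (k : nat) : sin (y + INR k * PI) = (-1) ^ k * sin y.
Proof.
induction k as [|k IH]; [simpl; now rewrite Rmult_0_l, Rplus_0_r, Rmult_1_l|].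
rewrite S_INR.
replace (y + (INR k + 1) * PI) with (y + INR k * PI + PI) by ring.
rewrite neg_sin, IH; simpl; ring.
Qed.

(** Both sides are the same quotient by [cos y], hence equal also at its zeros; this allows the
    global [is_derive_n_ext]. *)
Lemma tan_cot_shift (y : R) : tan y = - cot (y + PI / 2).
Proof.
unfold tan, cot; rewrite cos_plus, sin_plus, cos_PI2, sin_PI2.
unfold Rdiv; rewrite Ropp_mult_distr_l; f_equal; [|f_equal]; ring.
Qed.

(** Writing the cosine as a sine, the phase becomes [(1 - INR (eps n)) * (PI / 2)] plus [k + eps n]
    half turns; the remaining sign [- (-1) ^ n * (-1) ^ eps n] is 1 for either parity. *)
Lemma cos_quarter_shift (n k : nat) (x : R) :
  - (-1) ^ n * ((-1) ^ k * cos (INR (2 * k + eps n) * (x + PI / 2))) =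
  sin (INR (2 * k + eps n) * x + (1 - INR (eps n)) * (PI / 2)).
Proof.
rewrite (cos_sin (INR _ * _)), plus_INR, mult_INR.
replace (PI / 2 + (INR 2 * INR k + INR (eps n)) * (x + PI / 2)) with
  ((INR 2 * INR k + INR (eps n)) * x + (1 - INR (eps n)) * (PI / 2) +
   INR (k + eps n) * PI) by (rewrite plus_INR; simpl INR; field).
rewrite sin_add_nat_PI, pow_add.
generalize (sin ((INR 2 * INR k + INR (eps n)) * x + (1 - INR (eps n)) * (PI / 2))).
intros s.
transitivity (((-1) * (-1)) ^ k * (- (-1) ^ n * (-1) ^ eps n) * s);
  [rewrite Rpow_mult_distr; ring|].
replace ((-1) * (-1)) with 1 by ring; rewrite pow1.
replace ((-1) ^ n) with (2 * INR (eps n) - 1) by (rewrite eps_spec; field).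
unfold eps; destruct (Nat.even n); simpl; ring.
Qed.

Theorem theorem1p1 :
  forall n : nat, (1 <= n)%nat ->
    (forall x : R, cos x <> 0 ->
       is_derive_n tan n x
         (1 / cos x ^ (n + 1) *
          (1 / 2 * (1 + INR (eps n)) * a n (eps n) *
             sin (INR (eps n) * x + (1 - INR (eps n)) * (PI / 2)) +
           sum_n_m (fun k : nat =>
               a n (2 * k + eps n) *
               sin (INR (2 * k + eps n) * x + (1 - INR (eps n)) * (PI / 2)))
             1 ((n - 1 - eps n) / 2)))) /\
    (forall x : R, sin x <> 0 ->
       is_derive_n cot n x
         ((-1) ^ n / sin x ^ (n + 1) *
          (1 / 2 * (1 + INR (eps n)) * a n (eps n) * cos (INR (eps n) * x) +
           sum_n_m (fun k : nat =>
               (-1) ^ k * a n (2 * k + eps n) * cos (INR (2 * k + eps n) * x))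
             1 ((n - 1 - eps n) / 2)))).
Proof.
intros n Hn.
assert (Hcot : forall x, sin x <> 0 -> is_derive_n cot n x
  ((-1) ^ n / sin x ^ (n + 1) *
    (1 / 2 * (1 + INR (eps n)) * a n (eps n) * cos (INR (eps n) * x) +
     sum_n_m (fun k : nat =>
       (-1) ^ k * a n (2 * k + eps n) * cos (INR (2 * k + eps n) * x))
       1 ((n - 1 - eps n) / 2)))).
{ intros x Hx; rewrite <- cot_num_fold by exact Hn; now apply is_derive_n_cot. }
split; [|exact Hcot].
intros x Hx.
apply is_derive_n_ext with (fun y => - cot (y + PI / 2)).
{ intros y; now rewrite tan_cot_shift. }
assert (Es : sin (x + PI / 2) = cos x) by now rewrite Rplus_comm, <- cos_sin.
assert (Hs : sin (x + PI / 2) <> 0) by now rewrite Es.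
generalize (is_derive_n_opp (fun y => cot (y + PI / 2)) n x _
  (is_derive_n_comp_trans _ n x _ _ (Hcot _ Hs))).
rewrite Es.
match goal with |- is_derive_n _ _ _ ?u -> is_derive_n _ _ _ ?v =>
  replace v with u; [trivial|] end.
(* The leading term is put in the shape [k = 0] of [cos_quarter_shift], which then treats it like
   the others. *)
transitivity (1 / cos x ^ (n + 1) *
  (1 / 2 * (1 + INR (eps n)) * a n (eps n) *
     (- (-1) ^ n * ((-1) ^ 0 * cos (INR (2 * 0 + eps n) * (x + PI / 2)))) +
   - (-1) ^ n * sum_n_m (fun k : nat => (-1) ^ k * a n (2 * k + eps n) *
       cos (INR (2 * k + eps n) * (x + PI / 2))) 1 ((n - 1 - eps n) / 2))).
- simpl; field; now apply pow_nonzero.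
- rewrite cos_quarter_shift; f_equal; f_equal.
  etransitivity; [symmetry; apply (sum_n_m_mult_l (- (-1) ^ n))|].
  apply sum_n_m_ext_R; intros k _; rewrite <- cos_quarter_shift.
  unfold mult; simpl; ring.
Qed.
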